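(* Let $A$ be a finite alphabet and let $X \subseteq A^{\mathbb{N}}$ be a subshift. Then $X$ has positive topological entropy if and only if $X$ contains a steadily branching binary tree.
   Context: $\mathbb{N}$ contains $0$. An alphabet is a finite set $A$, and $A^{\mathbb{N}}$ carries the product topology ($A$ discrete). A subshift is a closed set $X \subseteq A^{\mathbb{N}}$ with $\sigma(X) \subseteq X$, where $\sigma(x)_i = x_{i+1}$. The words of $X$ are the finite words $w \in A^*$ such that $x|_{[0,|w|-1]} = w$ for some $x \in X$; $L_n$ denotes the set of words of $X$ of length $n$. The topological entropy is $h(X) = \lim_{n\to\infty} \frac{\log |L_n|}{n}$. For $z, b \in \mathbb{N}^{\mathbb{N}}$ write $z \leq b$ if $z_i \leq b_i$ for all $i$. For a set $X \subseteq A^{\mathbb{N}}$ and $b \in \mathbb{N}^{\mathbb{N}}$, a tree in $X$ with branching structure $b$ is a family $(x^z)_{z \in \mathbb{N}^{\mathbb{N}},\, z \leq b}$ with each $x^z \in X$ such that for all $z, z' \leq b$ and all $i \in \mathbb{N}$, $$x^z_{[0,i)} = x^{z'}_{[0,i)} \iff z_{[0,i)} = z'_{[0,i)}.$$ A steadily branching binary tree in $X$ is a tree in $X$ with a branching structure $b \in \{0,1\}^{\mathbb{N}}$ satisfying $\liminf_{i\to\infty} \frac{1}{i}\sum_{j=0}^{i-1} b_j > 0$; $X$ contains such a tree if one exists in $X$. *)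

(* Defs.v *)
From HB Require Import structures.
From mathcomp Require Import all_boot all_order all_algebra.
From mathcomp Require Import all_classical all_reals all_analysis.

Set Implicit Arguments.
Unset Strict Implicit.
Unset Printing Implicit Defensive.

Import Order.TTheory GRing.Theory Num.Theory.
Import numFieldNormedType.Exports.

Local Open Scope classical_set_scope.
Local Open Scope ring_scope.

(* Throughout, the finite word x_[0,n) is [mkseq x n] = [:: x 0; ...; x n.-1]. *)

Definition shift (A : finType) (x : nat -> A) : nat -> A := fun i => x i.+1.

Definition is_subshift (A : finType) (X : set (nat -> A)) : Prop :=
  closed (X : set {ptws nat -> discrete_topology A}) /\ @shift A @` X `<=` X.

Definition is_word (A : finType) (X : set (nat -> A)) (w : seq A) : Prop :=
  exists2 x, X x & mkseq x (size w) = w.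

Definition language (A : finType) (X : set (nat -> A)) (n : nat)
    : {set n.-tuple A} :=
  [set w : n.-tuple A | `[< is_word X w >]]%SET.

(* For a subshift the limit exists (Fekete).  Since [ln 0 = 0], the empty
   subshift gets entropy 0; the term n = 0 is 0 and is irrelevant. *)
Definition entropy (R : realType) (A : finType) (X : set (nat -> A)) : R :=
  limn (fun n : nat => ln (#|language X n|%:R : R) / n%:R).

Definition seq_le (z b : nat -> nat) : Prop := forall i, (z i <= b i)%N.

(* The family is a total function of z; only its values at z <= b matter. *)
Definition is_tree (A : finType) (X : set (nat -> A)) (b : nat -> nat)
    (x : (nat -> nat) -> nat -> A) : Prop :=
  (forall z, seq_le z b -> X (x z)) /\
  (forall z z', seq_le z b -> seq_le z' b -> forall i,
     mkseq (x z) i = mkseq (x z') i <-> mkseq z i = mkseq z' i).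

(* The averages lie in [0, 1], so the real-valued [limn_inf] is the genuine
   limit inferior. *)
Definition steadily_branching_binary (R : realType) (b : nat -> nat) : Prop :=
  (forall i, b i \in [:: 0%N; 1%N]) /\
  0 < limn_inf (fun i : nat => (\sum_(0 <= j < i) b j)%N%:R / i%:R : R).

Definition contains_steadily_branching_binary_tree (R : realType) (A : finType)
    (X : set (nat -> A)) : Prop :=
  exists b, steadily_branching_binary R b /\ exists x, is_tree X b x.

(* Main.v *)
Require Import Defs.
From HB Require Import structures.
From mathcomp Require Import all_boot all_order all_algebra.
From mathcomp Require Import all_classical all_reals all_analysis.
From mathcomp Require Import zify lra.

(** The easy direction is counting: a tree with branching [b] has
[2 ^ (b 0 + ... + b (n - 1))] distinct prefixes of length [n]
([card_language_ge_tree]), so positive lower density of [b] makes [ln |L_n| / n]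
eventually larger than a positive constant.  Fekete's lemma [fekete] provides
convergence of this sequence.

For the converse, call a finite 0-1 word [b] realized if some finite tree of
words of [X] branches exactly at the levels where [b] is true.  The argument has
three steps.

- Counting.  A Sauer-Shelah type inequality, [words_le_realizes], bounds the
  number of words of length [n] by the number of realized patterns of length [n],
  each weighted by [#|A| - 1] to the power of its number of branchings.  Hence,
  if all realized patterns had few branchings, the exponential growth rate of the
  number of words would be small ([ln_words_le_sparse]).

- Steadiness.  The realized patterns are closed under taking factors, because
  [X] is invariant under the shift.  If, for some length [m], every realized
  pattern had a prefix of density less than [1 / q], then cutting off such
  prefixes repeatedly would make all long realized patterns sparse
  ([sparse_of_not_steady]), against the previous step for suitable [q].  So for
  each [m] there is a realized pattern of length [m] all of whose prefixes have
  density at least [1 / q] ([steady_realized_words]).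

- Compactness.  Koenig's lemma [konig] yields an infinite [b] all of whose
  prefixes are realized and have density at least [1 / q].  Growing a tree
  through nodes that have subtrees of every finite depth gives an infinite tree
  with branching [b] whose finite paths are words of [X]
  ([tree_of_branching_stream]); its infinite paths are in [X] because [X] is
  closed ([subshift_limit]). *)

Set Implicit Arguments.
Unset Strict Implicit.
Unset Printing Implicit Defensive.

Import Order.TTheory GRing.Theory Num.Theory.
Import numFieldNormedType.Exports.

(** * Words and finite trees *)

Lemma big_tuple0 (T : finType) (M : Type) (idx : M)
    (op : Monoid.com_law idx) (F : seq T -> M) :
  \big[op/idx]_(w : 0.-tuple T) F w = F [::].
Proof. by rewrite (big_pred1 [tuple]) // => w; apply/esym/eqP/tuple0. Qed.

Lemma big_tupleS (T : finType) (M : Type) (idx : M)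
    (op : Monoid.com_law idx) (n : nat) (F : seq T -> M) :
  \big[op/idx]_(w : n.+1.-tuple T) F w =
  \big[op/idx]_(a : T) \big[op/idx]_(w : n.-tuple T) F (a :: w).
Proof.
rewrite pair_bigA /=.
pose h (p : T * n.-tuple T) := cons_tuple p.1 p.2.
rewrite (reindex h) //.
exists (fun w : n.+1.-tuple T => (thead w, behead_tuple w)) => [[a w] _|w _].
  by congr pair; apply/val_inj.
by apply/val_inj; case/tupleP: w.
Qed.

Definition words (A : finType) (S : seq A -> Prop) (n : nat) : nat :=
  \sum_(w : n.-tuple A) `[< S w >].

Definition after (A : Type) (S : seq A -> Prop) (u : seq A) : seq A -> Prop :=
  fun v => S (u ++ v).

Definition prefix_closed (T : Type) (S : seq T -> Prop) :=
  forall u v, S (u ++ v) -> S u.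

Definition shift_closed (A : Type) (S : seq A -> Prop) :=
  forall a v, S (a :: v) -> S v.

Lemma words0 (A : finType) (S : seq A -> Prop) : words S 0 = `[< S [::] >].
Proof. exact: (big_tuple0 _ (fun w => nat_of_bool `[< S w >])). Qed.

Lemma wordsS (A : finType) (S : seq A -> Prop) n :
  words S n.+1 = \sum_(a : A) words (after S [:: a]) n.
Proof. exact: (big_tupleS _ _ (fun w => nat_of_bool `[< S w >])). Qed.

Lemma words_le (A : finType) (S S' : seq A -> Prop) n :
  (forall w, S w -> S' w) -> words S n <= words S' n.
Proof.
move=> sSS'; apply: leq_sum => w _.
by case: (asboolP (S w)) => // /sSS' S'w; rewrite asboolT.
Qed.

(** [realizes S b] is the finite form of [is_tree]: some tree of words of [S]
has two distinct children at each node of depth [i] if [b] is true there, and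
at least one child otherwise.  As [a0 = a1] is allowed when [c] is false, one
clause covers both cases. *)
Fixpoint realizes (A : Type) (S : seq A -> Prop) (b : seq bool) : Prop :=
  if b is c :: b' then
    exists a0 a1, [/\ c -> a0 <> a1, realizes (after S [:: a0]) b'
                    & realizes (after S [:: a1]) b']
  else S [::].

Lemma realizesW (A : Type) (S S' : seq A -> Prop) b :
  (forall w, S w -> S' w) -> realizes S b -> realizes S' b.
Proof.
elim: b S S' => [|c b IH] S S' sSS' /=; first exact: sSS'.
case=> a0 [a1 [a01 r0 r1]]; exists a0, a1; split=> //.
  by apply: IH r0 => w; apply: sSS'.
by apply: IH r1 => w; apply: sSS'.
Qed.

Lemma after_prefix_closed (A : Type) (S : seq A -> Prop) u :
  prefix_closed S -> prefix_closed (after S u).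
Proof. by move=> Sp v w; rewrite /after catA; apply: Sp. Qed.

Lemma realizes_prefix_closed (A : Type) (S : seq A -> Prop) :
  prefix_closed S -> prefix_closed (realizes S).
Proof.
move=> Sp b b'; elim: b S Sp => [|c b IH] S Sp /=.
  elim: b' S Sp => [|c b' IH] S Sp //= [a [_ [_ ra _]]].
  have /IH : prefix_closed (after S [:: a]) by apply: after_prefix_closed.
  by move=> /(_ ra); apply: (Sp [::]).
case=> a0 [a1 [a01 r0 r1]]; exists a0, a1; split=> //.
  by apply: IH r0; apply: after_prefix_closed.
by apply: IH r1; apply: after_prefix_closed.
Qed.

(** The subtree hanging below a node of a tree of words of [S] consists of
suffixes of words of [S], so it is again a tree in [S]. *)
Lemma realizes_drop (A : Type) (S : seq A -> Prop) j b :
  shift_closed S -> realizes S b -> realizes S (drop j b).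
Proof.
move=> Ss; elim: j b => [|j IH] [|c b] //= [a [_ [_ ra _]]].
by apply: IH; apply: realizesW ra => w; apply: Ss.
Qed.

Lemma words_submul (A : finType) (S S' : seq A -> Prop) m n :
  prefix_closed S -> (forall u v, S (u ++ v) -> S' v) ->
  words S (m + n) <= words S m * words S' n.
Proof.
elim: m S => [|m IH] S Sp SS'; last first.
  rewrite addSn !wordsS big_distrl /=; apply: leq_sum => a _.
  apply: IH; first exact: after_prefix_closed.
  by move=> u v; apply: (SS' (a :: u)).
rewrite words0; case: asboolP => [_|nS].
  by rewrite mul1n; apply: words_le => v; apply: (SS' [::]).
rewrite mul0n /words big1 // => w _; rewrite asboolF //.
by move=> Sw; apply: nS; apply: (Sp [::] w).
Qed.

(** * Counting words by the branching patterns they realize *)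

(** A first solution of [P] counts 1, and as soon as there is a second one,
[#|A|.-1] pays for all the others at once.  This is the shape of the induction
step of [words_le_realizes]. *)
Lemma sum_asbool_le (A : finType) (P : A -> Prop) :
  \sum_(a : A) `[< P a >] <=
  `[< exists a, P a >] + #|A|.-1 * `[< exists a0 a1, [/\ a0 <> a1, P a0 & P a1] >].
Proof.
have -> : \sum_(a : A) `[< P a >] = #|[pred a | `[< P a >]]|.
  rewrite -sum1_card [RHS]big_mkcond /=; apply: eq_bigr => a _.
  by rewrite unfold_in; case: asbool.
case: (leqP #|[pred a | `[< P a >]]| 1) => [le1|/card_gt1P].
  apply: leq_trans (leq_addr _ _).
  case: (posnP #|[pred a | `[< P a >]]|) => [->//|/card_gt0P [a]].
  by rewrite inE => Pa; rewrite asboolT //; exists a.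
case=> a0 [a1 []]; rewrite !inE => P0 P1 /eqP a01.
rewrite !asboolT; [|by exists a0, a1|by exists a0].
by rewrite muln1 add1n; apply: leq_trans (max_card _) (leqSpred _).
Qed.

(** A multi-letter version of the Sauer-Shelah lemma, in its order-shattering
form.  By induction on [n], for each first letter [a] the words after [a] are
bounded by a weighted count of the patterns [b] realized after [a].  If [b] is
realized after some letter then [false :: b] is realized by [S], and if it is
realized after two letters then so is [true :: b]; the weight [#|A|.-1] of the
additional [true] pays for all letters beyond the first. *)
Lemma words_le_realizes (A : finType) (S : seq A -> Prop) n :
  words S n <=
  \sum_(b : n.-tuple bool) `[< realizes S b >] * #|A|.-1 ^ count id b.
Proof.
elim: n S => [|n IH] S.
  rewrite words0 (big_tuple0 _ (fun b => `[< realizes S b >] * #|A|.-1 ^ count id b)).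
  by rewrite muln1.
rewrite wordsS (big_tupleS _ _ (fun b => `[< realizes S b >] * #|A|.-1 ^ count id b)).
rewrite big_bool /= -big_split /=.
apply: leq_trans; first by apply: leq_sum => a _; apply: IH.
rewrite exchange_big /=; apply: leq_sum => b _; rewrite -big_distrl /=.
apply: leq_trans (leq_mul (sum_asbool_le _) (leqnn _)) _.
rewrite mulnDl addnC leq_add //.
  rewrite add1n expnS mulnA leq_mul // mulnC leq_mul //.
  by case: asboolP => // -[a0 [a1 [a01 r0 r1]]]; rewrite asboolT //; exists a0, a1.
rewrite add0n leq_mul //; case: asboolP => // -[a ra].
by rewrite asboolT //; exists a, a.
Qed.

(** The binomial theorem, before grouping the patterns by number of [true]. *)
Lemma sum_binary_weights (K s n : nat) :
  \sum_(b : n.-tuple bool) K ^ count id b * s ^ count negb b = (K + s) ^ n.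
Proof.
pose F b := K ^ count id b * s ^ count negb b; rewrite -/F.
elim: n => [|n IH]; first by rewrite (big_tuple0 _ F).
rewrite (big_tupleS _ _ F) big_bool /F /= expnS -{}IH mulnDl !big_distrr /=.
congr (_ + _); apply: eq_bigr => b _; rewrite add0n add1n expnS.
  by rewrite mulnA.
by rewrite mulnCA.
Qed.

(** Chernoff-type estimate.  If realized patterns have at most [D] branchings,
then [s ^ n <= s ^ D * s ^ (number of non-branchings)] for each of them, and the
restricted weighted count is bounded by an unrestricted one. *)
Lemma words_le_sparse (A : finType) (S : seq A -> Prop) n D s : 0 < s ->
  (forall b, size b = n -> realizes S b -> count id b <= D) ->
  words S n * s ^ n <= s ^ D * (#|A|.-1 + s) ^ n.
Proof.
move=> s0 bD; apply: leq_trans (leq_mul (words_le_realizes S n) (leqnn _)) _.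
rewrite -sum_binary_weights big_distrl big_distrr /=; apply: leq_sum => b _.
case: asboolP => // /(bD _ (size_tuple b)) cD; rewrite mul1n.
rewrite mulnCA leq_mul // -[n in s ^ n](size_tuple b) -(count_predC id b) expnD.
by rewrite leq_mul // leq_pexp2l.
Qed.

(** * Steady patterns *)

(** Every prefix of [b] has density of [true] at least [1 / q]; stated without
division. *)
Definition steady_word (q : nat) (b : seq bool) :=
  forall j, j <= size b -> j <= q * count id (take j b).

Lemma steady_word_prefix_closed q : prefix_closed (steady_word q).
Proof.
move=> u v st j ju; have := st j; rewrite size_cat take_cat.
have -> : (if j < size u then take j u else u ++ take (j - size u) v) = take j u.
  case: ltnP => // uj; have -> : j = size u by apply/anti_leq; rewrite ju.
  by rewrite subnn take0 cats0 take_size.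
by apply; rewrite (leq_trans ju) // leq_addr.
Qed.

(** If no pattern of length [m] in [P] is steady, every pattern of length at least
[m] in [P] starts with a nonempty block, of length at most [m], with density less
than [1 / q].  Cutting off such blocks repeatedly leaves a rest shorter than
[m], so the whole pattern has density at most [1 / q] up to the constant
[q * m]. *)
Lemma sparse_of_not_steady (P : seq bool -> Prop) q m :
  prefix_closed P -> (forall j b, P b -> P (drop j b)) ->
  (forall b, size b = m -> P b -> ~ steady_word q b) ->
  forall b, P b -> q * count id b <= size b + q * m.
Proof.
move=> Pp Pd nost b; have [n] := ubnP (size b).
elim: n b => // n IH b /ltnSE sb Pb.
case: (ltnP (size b) m) => [bm|mb].
  apply: leq_trans (leq_addl _ _); rewrite leq_mul //.
  exact: leq_trans (count_size _ _) (ltnW bm).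
have Pt : P (take m b) by apply: (Pp _ (drop m b)); rewrite cat_take_drop.
have /existsNP [j /not_implyP [jm /negP]] := nost _ (size_takel mb) Pt.
rewrite size_takel // in jm.
rewrite take_takel // -ltnNge => qj.
have j0 : 0 < j by case: j qj {jm} => //; rewrite take0 muln0.
have := IH (drop j b) _ (Pd _ _ Pb); rewrite size_drop => /(_ ltac:(lia)).
have -> : count id b = count id (take j b) + count id (drop j b).
  by rewrite -count_cat cat_take_drop.
rewrite mulnDr; lia.
Qed.

(** * Compactness: from finite patterns and trees to infinite ones *)

(** If every [t] failed at some level, all would fail at the largest of these
levels, because [Q] is decreasing in [m]. *)
Lemma finite_pigeonhole (T : finType) (Q : nat -> T -> Prop) :
  (forall m t, Q m.+1 t -> Q m t) -> (forall m, exists t, Q m t) ->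
  exists t, forall m, Q m t.
Proof.
move=> QS Qex; apply: contrapT => /forallNP noT.
have /choice [f fP] : forall t, exists m, ~ Q m t.
  by move=> t; apply/existsNP; apply: noT.
have Qle m n t : m <= n -> Q n t -> Q m t.
  by move=> /subnK <-; elim: (n - m) => // k IH /QS.
have [t Qt] := Qex (\max_t f t).
by apply: (fP t); apply: Qle Qt; apply: leq_bigmax.
Qed.

Lemma konig (T : finType) (P : seq T -> Prop) :
  prefix_closed P -> (forall m, exists2 v, size v = m & P v) ->
  exists b : nat -> T, forall m, P (mkseq b m).
Proof.
move=> Pp Pex.
(* [v] is good if [P] holds for extensions of [v] of every length. *)
pose good v := forall m, exists2 w, size w = m & P (v ++ w).
have step v : exists a, good v -> good (rcons v a).
  case: (pselect (good v)) => [gv|ngv].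
    have [|m|a aP] := @finite_pigeonhole T
        (fun m a => exists2 w, size w = m & P (rcons v a ++ w)).
    - move=> m a [w sw Pw]; exists (take m w).
        by rewrite size_takel ?sw.
      by apply: (Pp _ (drop m w)); rewrite -catA cat_take_drop.
    - by have [[|a w] // [sw] Pw] := gv m.+1; exists a, w; rewrite // cat_rcons.
    by exists a.
  have [[|a w] // _ _] := Pex 1.
  by exists a.
have [f fP] := choice step.
(* [V n] is the good prefix of length [n] obtained by following [f]. *)
pose V := fix V n := if n is n'.+1 then rcons (V n') (f (V n')) else [::].
have Vgood n : good (V n).
  by elim: n => [|n IH] /=; [exact: Pex|exact: fP].
exists (fun n => f (V n)) => m.
have -> : mkseq (fun n => f (V n)) m = V m by elim: m => // m IH; rewrite mkseqS IH.
by have [w /size0nil -> ] := Vgood m 0; rewrite cats0.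
Qed.

Lemma eq_mkseqP (T : Type) (x y : nat -> T) n :
  mkseq x n = mkseq y n <-> forall i, i < n -> x i = y i.
Proof.
split=> [e i lt_in|e]; last first.
  by apply/eq_in_map => i; rewrite mem_iota => /andP[_]; apply: e.
by rewrite -(nth_mkseq (x 0) x lt_in) e nth_mkseq.
Qed.

Definition branching_stream (A : Type) (S : seq A -> Prop) (b : nat -> bool) :=
  forall m, realizes S (mkseq b m).

(** For each depth [m] there is a pair of first letters below which trees of
depth [m] grow; since there are finitely many pairs, one pair serves all
depths. *)
Lemma branching_stream_step (A : finType) (S : seq A -> Prop) b :
  prefix_closed S -> branching_stream S b ->
  exists e : bool -> A, (b 0 -> e false <> e true) /\
    forall c, branching_stream (after S [:: e c]) (fun i => b i.+1).
Proof.
move=> Sp Sb.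
pose Q m (p : A * A) := [/\ b 0 -> p.1 <> p.2,
  realizes (after S [:: p.1]) (mkseq (fun i => b i.+1) m)
  & realizes (after S [:: p.2]) (mkseq (fun i => b i.+1) m)].
have [m p [a01 r0 r1]|m|[a0 a1] aP] := @finite_pigeonhole _ Q.
- split=> //.
    move: r0; rewrite mkseqS -cats1; apply: realizes_prefix_closed.
    exact: after_prefix_closed.
  move: r1; rewrite mkseqS -cats1; apply: realizes_prefix_closed.
  exact: after_prefix_closed.
- have := Sb m.+1; rewrite /mkseq /= -[1]/(1 + 0) iotaDl -map_comp.
  by case=> a0 [a1 h]; exists (a0, a1).
exists (fun c => if c then a1 else a0); split; first by case: (aP 0).
by case=> m; case: (aP m).
Qed.

(** [e u c] is the child chosen at the node [u], for a turn [c].  The turn taken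
at depth [n] is [z n != 0], which loses nothing as [z] has values in {0, 1}. *)
Definition node (A : Type) (e : seq A -> bool -> A) (z : nat -> nat) :=
  fix node n := if n is n'.+1 then rcons (node n') (e (node n') (z n' != 0)) else [::].

Definition branch (A : Type) (e : seq A -> bool -> A) (z : nat -> nat) : nat -> A :=
  fun n => e (node e z n) (z n != 0).

Lemma mkseq_branch (A : Type) (e : seq A -> bool -> A) z n :
  mkseq (branch e z) n = node e z n.
Proof. by elim: n => // n IH; rewrite mkseqS IH. Qed.

(** Finite trees of every depth with the same pattern yield one infinite tree.
The tree is grown from the root, keeping only nodes below which trees of every
depth exist; [branching_stream_step] says that such a node has enough children
of the same kind. *)
Lemma tree_of_branching_stream (A : finType) (S : seq A -> Prop) (b : nat -> bool) :
  prefix_closed S -> branching_stream S b ->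
  exists x : (nat -> nat) -> nat -> A,
    (forall z n, S (mkseq (x z) n)) /\
    (forall z z', (forall i, z i <= b i) -> (forall i, z' i <= b i) ->
      forall i, mkseq (x z) i = mkseq (x z') i <-> mkseq z i = mkseq z' i).
Proof.
move=> Sp Sb.
pose good u := branching_stream (after S u) (fun i => b (size u + i)).
(* A default letter, for nodes that are not good. *)
have [a _] : exists a : A, true by have [a _] := Sb 1; exists a.
have /choice [e eP] : forall u, exists e : bool -> A, good u ->
    (b (size u) -> e false <> e true) /\ forall c, good (rcons u (e c)).
  move=> u; case: (pselect (good u)) => [gu|ngu]; last by exists (fun=> a).
  have [e [e01 eg]] := branching_stream_step (after_prefix_closed Sp) gu.
  exists e => _; split; first by move: e01; rewrite addn0.
  move=> c m; rewrite size_rcons; have := eg c m; rewrite /after.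
  under eq_mkseq do rewrite addnS -addSn.
  by apply: realizesW => w; rewrite cat_rcons.
have size_node z n : size (node e z n) = n.
  by elim: n => //= n IH; rewrite size_rcons IH.
have gnode z n : good (node e z n).
  by elim: n => [|n IH] //=; have [_] := eP _ IH; apply.
exists (branch e); split=> [z n|z z' zb z'b i].
  by rewrite mkseq_branch; have := gnode z n 0; rewrite /= /after cats0.
rewrite !mkseq_branch; split; last first.
  elim: i => //= i IH; rewrite !mkseqS => /rcons_inj[zz' ->].
  by rewrite IH.
elim: i => //= i IH /rcons_inj[nn']; rewrite !mkseqS (IH nn') nn' => ee.
congr rcons; have [+ _] := eP _ (gnode z' i); rewrite size_node => e01.
have := zb i; have := z'b i.
case: (b i) e01 => [/(_ isT) e01|_] /=.
  by case: (z i) (z' i) ee => [|[]] // [|[]] //= ee _ _; case: e01.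
by case: (z i) (z' i) => [|?] [|?].
Qed.

(** * The language of a subshift *)

Lemma is_word_prefix_closed (A : finType) (X : set (nat -> A)) :
  prefix_closed (is_word X).
Proof.
move=> u v [x Xx xuv]; exists x => //.
have := congr1 (take (size u)) xuv.
by rewrite take_size_cat // /mkseq -map_take take_iota size_cat (minn_idPl (leq_addr _ _)).
Qed.

Lemma is_word_shift_closed (A : finType) (X : set (nat -> A)) :
  is_subshift X -> shift_closed (is_word X).
Proof.
move=> [_ shX] a v [x Xx xav]; exists (Defs.shift x); first by apply: shX; exists x.
by case: xav => _; rewrite -[1]/(1 + 0) iotaDl -map_comp.
Qed.

Lemma card_language (A : finType) (X : set (nat -> A)) n :
  #|language X n| = words (is_word X) n.
Proof.
rewrite -sum1_card big_mkcond /=; apply: eq_bigr => w _.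
by rewrite /language finset.inE; case: asbool.
Qed.

(** The tree property makes distinct branching choices before time [n] lead to
distinct words of length [n], and there are [2 ^ (sum of the b j)] choices. *)
Lemma card_language_ge_tree (A : finType) (X : set (nat -> A)) b x n :
  (forall i, b i \in [:: 0; 1]) -> is_tree X b x ->
  2 ^ (\sum_(0 <= j < n) b j) <= #|language X n|.
Proof.
move=> b01 [xX xE].
(* A choice vector is extended by 0 beyond [n] to get an index of the tree. *)
pose ext (f : {ffun 'I_n -> bool}) (i : nat) : nat :=
  if insub i is Some j then f j else 0.
pose Z := family (fun i : 'I_n => [pred c : bool | c <= b i]).
have extE f (i : 'I_n) : ext f i = f i by rewrite /ext valK.
have extb f : f \in Z -> seq_le (ext f) b.
  move=> /familyP fZ i; rewrite /ext; case: insubP => // j _ <-.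
  by have := fZ j; rewrite inE.
have <- : #|Z| = 2 ^ \sum_(0 <= j < n) b j.
  rewrite card_family foldrE big_map big_enum /= big_mkord.
  rewrite (big_morph (fun k => 2 ^ k) (expnD 2) (expn0 2)).
  apply: eq_bigr => i _; have := b01 i; rewrite !inE => /orP[] /eqP ->.
    by rewrite (@fintype.eq_card1 _ false) // => -[].
  by rewrite (@fintype.eq_card _ _ predT) ?card_bool // => -[].
pose g f := [tuple of mkseq (x (ext f)) n].
have ginj : {in Z &, injective g}.
  move=> f f' /extb fb /extb fb' /(congr1 val) /= /(xE _ _ fb fb') /eq_mkseqP e.
  apply/ffunP => i; have := e i (ltn_ord i).
  by rewrite !extE; case: (f i) (f' i) => [] [].
rewrite -(card_in_imset ginj); apply/subset_leq_card/fintype.subsetP => _ /imsetP[f fZ ->].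
rewrite /language finset.inE; apply/asboolP; exists (x (ext f)); first exact/xX/extb.
by rewrite size_mkseq.
Qed.

Lemma sum_nat_of_bool_mkseq (b : nat -> bool) n :
  (\sum_(0 <= j < n) b j = count id (mkseq b n))%N.
Proof.
elim: n => [|n IH]; first by rewrite big_geq.
by rewrite mkseqS -cats1 count_cat -IH big_nat_recr //= addn0.
Qed.

Local Open Scope classical_set_scope.
Local Open Scope ring_scope.

(** This is where closedness of [X] in the product topology enters: points of [X]
sharing longer and longer prefixes with [x] converge pointwise to [x]. *)
Lemma subshift_limit (A : finType) (X : set (nat -> A)) x :
  is_subshift X -> (forall n, is_word X (mkseq x n)) -> X x.
Proof.
move=> [clX _] xw.
have /choice [y yP] : forall n, exists y, X y /\ mkseq y n = mkseq x n.
  by move=> n; have [y Xy] := xw n; rewrite size_mkseq; exists y.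
apply: (@closed_cvg _ {ptws nat -> discrete_topology A} \oo _ y X clX).
  by apply: nearW => n; case: (yP n).
apply/(@pointwise_cvgP nat (discrete_topology A)) => i.
apply/discrete_cvg; exists i.+1 => // n /= lt_in.
by have [_ /eq_mkseqP] := yP n; apply.
Qed.

(** * Subadditive sequences and lower limits *)

Lemma subadditive_mulD (R : realType) (a : nat -> R) :
  (forall m n, a (m + n)%N <= a m + a n) ->
  forall k m r, a (k * m + r)%N <= k%:R * a m + a r.
Proof.
move=> asub; elim=> [|k IH] m r; first by rewrite mul0n mul0r add0r.
rewrite mulSn -addnA (le_trans (asub _ _)) // mulrSr mulrDl mul1r.
by rewrite -addrA addrCA lerD2l.
Qed.

(** Fekete's lemma, for nonnegative sequences.  The limit is the infimum of the
[a n / n] over positive [n]: if [a m / m] is close to it, dividing [n] by [m]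
bounds [a n] by [n * (a m / m)] plus a constant. *)
Lemma fekete (R : realType) (a : nat -> R) :
  (forall n, 0 <= a n) -> (forall m n, a (m + n)%N <= a m + a n) ->
  cvgn (fun n => a n / n%:R).
Proof.
move=> a0 asub.
pose Q := [set a n.+1 / n.+1%:R | n in [set: nat]].
have Qlb : lbound Q 0 by move=> _ [n _ <-]; rewrite divr_ge0.
have Qinf : has_inf Q by split; [exists (a 1%N / 1%:R), 0%N | exists 0].
apply/cvg_ex; exists (inf Q); apply/cvgrPdist_le => /= e e0.
have e20 : 0 < e / 2 by rewrite divr_gt0.
have [_ [k _ <-] ak] := inf_adherent e20 Qinf.
set m := k.+1 in ak.
(* [C] bounds [a r] for all remainders [r] modulo [m]. *)
pose C := \sum_(r < m) a r.
near=> n.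
have n0 : (0 < n)%N by near: n; exact: nbhs_infty_gt.
have nR : 0 < n%:R :> R by rewrite ltr0n.
have mR : 0 < m%:R :> R by rewrite ltr0n.
have Cn : C <= e / 2 * n%:R.
  rewrite -ler_pdivrMl //; near: n; exact: nbhs_infty_ger.
have lo : inf Q <= a n / n%:R.
  by apply: ge_inf; [exists 0|exists n.-1; rewrite ?prednK].
have arC : a (n %% m)%N <= C.
  rewrite /C (bigD1 (Ordinal (ltn_pmod n (ltn0Sn k)))) //= lerDl.
  by apply: sumr_ge0.
have hi : a n <= (inf Q + e / 2) * n%:R + C.
  rewrite {1}(divn_eq n m) (le_trans (subadditive_mulD asub _ _ _)) //.
  apply: lerD => //.
  have am : a m <= (inf Q + e / 2) * m%:R by rewrite -ler_pdivrMr // ltW.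
  rewrite (le_trans (ler_wpM2l _ am)) // mulrCA -natrM ler_wpM2l //.
    rewrite addr_ge0 ?(ltW e20) //; apply: lb_le_inf => //.
    by case: Qinf.
  by rewrite ler_nat leq_trunc_div.
rewrite distrC ger0_norm ?subr_ge0 // lerBlDr ler_pdivrMr //.
apply: (le_trans hi); lra.
Unshelve. all: by end_near. Qed.

Lemma bounded_fun_itv01 (R : realType) (u : nat -> R) :
  (forall n, 0 <= u n <= 1) -> bounded_fun (u : R^o^nat).
Proof.
move=> u01; exists 1; split=> [|M M1 n _]; first exact: num_real.
by have /andP[u0 u1] := u01 n; rewrite /= ger0_norm // (le_trans u1) // ltW.
Qed.

Lemma limn_inf_gt0_eventually (R : realType) (u : nat -> R) :
  (forall n, 0 <= u n <= 1) ->
  0 < limn_inf u -> exists2 c : R, 0 < c & exists N, forall n, (N <= n)%N -> c <= u n.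
Proof.
move=> u01; have ub := bounded_fun_itv01 u01.
rewrite (limn_infE ub) => sup0.
have [|_ [N _ <-] c0] := sup_gt _ sup0; first by exists (infs u 0%N), 0%N.
exists (infs u N) => //; exists N => n Nn.
apply: ge_inf; last by exists n.
by exists 0 => _ [k _ <-]; case/andP: (u01 k).
Qed.

Lemma limn_inf_ge (R : realType) (u : nat -> R) c :
  (forall n, 0 <= u n <= 1) ->
  (forall n, (0 < n)%N -> c <= u n) -> c <= limn_inf u.
Proof.
move=> u01 cu; have ub := bounded_fun_itv01 u01.
rewrite (limn_infE ub).
apply: (@le_trans _ _ (infs u 1%N)).
  apply: lb_le_inf; first by exists (u 1%N), 1%N => /=.
  by move=> _ [n /= n1 <-]; apply: cu.
apply: ub_le_sup; last by exists 1%N.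
exact: bounded_fun_has_ubound_infs.
Qed.

Lemma average01 (R : realType) (b : nat -> nat) n :
  (forall i, b i \in [:: 0; 1]%N) ->
  0 <= ((\sum_(0 <= j < n) b j)%N%:R / n%:R : R) <= 1.
Proof.
move=> b01; rewrite divr_ge0 //=; case: n => [|n]; first by rewrite invr0 mulr0.
rewrite ler_pdivrMr // mul1r ler_nat -[leqRHS]subn0 -[leqRHS]muln1 -sum_nat_const_nat.
by apply: leq_sum => i _; have := b01 i; rewrite !inE => /orP[] /eqP ->.
Qed.

(** * Entropy and branching *)

Lemma ln_nat_ge0 (R : realType) (n : nat) : 0 <= ln n%:R :> R.
Proof. by case: n => [|n]; [rewrite ln0 | rewrite ln_ge0 // ler1n]. Qed.

(** As [limn] is only meaningful for convergent sequences, lower bounds on the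
terms bound the entropy only once convergence is known. *)
Lemma entropy_cvg (R : realType) (A : finType) (X : set (nat -> A)) :
  is_subshift X -> cvgn (fun n => ln (#|language X n|%:R : R) / n%:R).
Proof.
move=> Xs; apply: fekete => [n|m n]; first exact: ln_nat_ge0.
have : (#|language X (m + n)| <= #|language X m| * #|language X n|)%N.
  rewrite !card_language; apply: words_submul; first exact: is_word_prefix_closed.
  by elim=> //= a u IH v uv; apply/IH/(is_word_shift_closed Xs uv).
move: (#|language X (m + n)|) (#|language X m|) (#|language X n|) => k i j.
case: k => [_|k kij]; first by rewrite ln0 // addr_ge0 ?ln_nat_ge0.
have /andP[i0 j0] : (0 < i)%N && (0 < j)%N by rewrite -muln_gt0 (leq_trans _ kij).
by rewrite -lnM ?posrE ?ltr0n // ler_ln ?posrE -?natrM ?ltr0n ?muln_gt0 ?i0 // ler_nat.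
Qed.

(** Logarithmic form of [words_le_sparse] with [D = n %/ q + m], using
[ln (K + s) <= ln s + K / s].  For large [s] and then large [q] the first two
summands are arbitrarily small, and the last one tends to 0. *)
Lemma ln_words_le_sparse (R : realType) (A : finType) (S : seq A -> Prop) q m n s :
  (0 < s)%N -> (0 < q)%N -> (0 < n)%N -> (0 < words S n)%N ->
  (forall b, size b = n -> realizes S b ->
     (q * count id b <= n + q * m)%N) ->
  ln (words S n)%:R / n%:R <=
    ln s%:R / q%:R + #|A|.-1%:R / s%:R + m%:R * ln s%:R / n%:R :> R.
Proof.
move=> s0 q0 n0 w0 sparse.
set K := #|A|.-1.
have nR : 0 < n%:R :> R by rewrite ltr0n.
have sR : 0 < s%:R :> R by rewrite ltr0n.
have KsR : 0 < (K + s)%:R :> R by rewrite ltr0n addn_gt0 s0 orbT.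
have wR : 0 < (words S n)%:R :> R by rewrite ltr0n.
have := @words_le_sparse A S n (n %/ q + m) s s0.
have cD b : size b = n -> realizes S b -> (count id b <= n %/ q + m)%N.
  move=> sb rb; rewrite addnC -divnMDl // leq_divRL // mulnC.
  by rewrite addnC [(m * q)%N]mulnC sparse.
rewrite -/K => /(_ cD); rewrite -(ler_nat R) !natrM !natrX => le0.
have sX k : 0 < s%:R ^+ k :> R by rewrite exprn_gt0.
have lnX (x : R) k : 0 < x -> ln (x ^+ k) = k%:R * ln x.
  by move=> x0; rewrite lnXn // mulr_natl.
have KX : 0 < (K + s)%:R ^+ n :> R by rewrite exprn_gt0.
have : ln ((words S n)%:R * s%:R ^+ n) <=
    ln (s%:R ^+ (n %/ q + m) * (K + s)%:R ^+ n) :> R.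
  by rewrite ler_ln // posrE mulr_gt0.
rewrite lnM ?posrE // [X in _ <= X]lnM ?posrE // !lnX // natrD mulrDl => le1.
have ls0 : 0 <= ln (s%:R) :> R := ln_nat_ge0 R s.
have nq : (n %/ q)%:R * ln s%:R <= n%:R * (ln s%:R / q%:R) :> R.
  rewrite mulrA mulrAC ler_wpM2r // ler_pdivlMr ?ltr0n // -natrM ler_nat.
  exact: leq_trunc_div.
have lK : ln (K + s)%:R <= ln s%:R + K%:R / s%:R :> R.
  have -> : (K + s)%:R = s%:R * (1 + K%:R / s%:R) :> R.
    by rewrite mulrDr mulr1 mulrCA divff ?mulr1 ?natrD 1?addrC // gt_eqF.
  have Ks0 : 0 <= K%:R / s%:R :> R by rewrite divr_ge0.
  rewrite lnM ?posrE ?ltr_pwDl // lerD2l le_ln1Dx //.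
  by rewrite (lt_le_trans _ Ks0) // ltrN10.
rewrite ler_pdivrMr // !mulrDl divfK ?gt_eqF //.
have := ler_wpM2l (ltW nR) lK; rewrite mulrDr => le2.
lra.
Qed.

(** Positive entropy forces steady realized patterns of every length: otherwise
[sparse_of_not_steady] and [ln_words_le_sparse] would bound the entropy by
[h / 3 + h / 3]. *)
Lemma steady_realized_words (R : realType) (A : finType) (X : set (nat -> A)) :
  is_subshift X -> 0 < entropy R X ->
  exists2 q : nat, (0 < q)%N & forall m, exists2 b, size b = m &
    realizes (is_word X) b /\ steady_word q b.
Proof.
move=> Xs h0; set h := entropy R X in h0 *.
have h3 : 0 < h / 3 by rewrite divr_gt0.
(* [s] makes the second summand of [ln_words_le_sparse] less than [h / 3], and
   then [q] makes the first one so. *)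
pose s := (Num.truncn (#|A|.-1%:R / (h / 3))).+1.
pose q := (Num.truncn (ln (s%:R : R) / (h / 3))).+1.
have sK : #|A|.-1%:R / s%:R < h / 3 :> R.
  by rewrite ltr_pdivrMr // mulrC -ltr_pdivrMr // truncnS_gt.
have qs : ln s%:R / q%:R < h / 3 :> R.
  by rewrite ltr_pdivrMr // mulrC -ltr_pdivrMr // truncnS_gt.
exists q => // m; apply: contrapT => nob.
have nost b : size b = m -> realizes (is_word X) b -> ~ steady_word q b.
  by move=> sb rb st; apply: nob; exists b.
have sparse b : realizes (is_word X) b -> (q * count id b <= size b + q * m)%N.
  apply: (sparse_of_not_steady _ _ nost).
    exact/realizes_prefix_closed/is_word_prefix_closed.
  by move=> j b' rb'; apply: realizes_drop => //; apply: is_word_shift_closed.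
have h6 : 0 < h / 6 by rewrite divr_gt0.
have /cvgrPdist_lt /(_ _ h6) ch := entropy_cvg (R := R) Xs.
(* At a large [n] the third summand and the distance to [h] are at most [h / 6],
   so the term would be both above [5 h / 6] and below it. *)
near \oo => n.
have n0 : (0 < n)%N by near: n; exact: nbhs_infty_gt.
have nR : 0 < n%:R :> R by rewrite ltr0n.
have mn : m%:R * ln s%:R / n%:R <= h / 6.
  rewrite ler_pdivrMr // -ler_pdivrMl //; near: n; exact: nbhs_infty_ger.
have close : `|h - ln (#|language X n|%:R : R) / n%:R| < h / 6 by near: n.
have low : h - h / 6 < ln (#|language X n|%:R : R) / n%:R.
  by rewrite ltrBlDr -ltrBlDl (le_lt_trans (ler_norm _) close).
have w0 : (0 < words (is_word X) n)%N.
  rewrite -card_language lt0n; apply/eqP => L0.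
  move: low; rewrite L0 ln0 // mul0r; lra.
have sp b : size b = n -> realizes (is_word X) b -> (q * count id b <= n + q * m)%N.
  by move=> <-; apply: sparse.
have := ln_words_le_sparse R (ltn0Sn _ : 0 < s)%N (ltn0Sn _ : 0 < q)%N n0 w0 sp.
rewrite -card_language; lra.
Unshelve. all: by end_near. Qed.

Theorem theorem1 (R : realType) (A : finType) (X : set (nat -> A)) :
  is_subshift X ->
  (0 < entropy R X <-> contains_steadily_branching_binary_tree R X).
Proof.
move=> Xs; split=> [h0|[b [[b01 b0] [x xT]]]].
  have [q q0 qP] := steady_realized_words Xs h0.
  pose P v := realizes (is_word X) v /\ steady_word q v.
  have Pp : prefix_closed P.
    move=> u v [ru su]; split; last exact: steady_word_prefix_closed su.
    exact: (realizes_prefix_closed (@is_word_prefix_closed _ X)) ru.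
  have [b bP] := konig Pp qP.
  have rb : branching_stream (is_word X) b by move=> m; case: (bP m).
  have [x [xw xE]] := tree_of_branching_stream (@is_word_prefix_closed _ X) rb.
  exists (fun i => nat_of_bool (b i)); split.
    have b01 i : nat_of_bool (b i) \in [:: 0; 1]%N by case: (b i).
    split=> //; apply: (@lt_le_trans _ _ q%:R^-1); first by rewrite invr_gt0 ltr0n.
    apply: limn_inf_ge => n; first exact: average01.
    move=> n0; rewrite ler_pdivlMr ?ltr0n // mulrC ler_pdivrMr ?ltr0n //.
    rewrite -natrM ler_nat sum_nat_of_bool_mkseq mulnC.
    have [_ /(_ n)] := bP n; rewrite size_mkseq leqnn => /(_ isT).
    by rewrite take_oversize // size_mkseq.
  exists x; split=> [z _|]; first exact: subshift_limit.
  exact: xE.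
have [c c0 [N cN]] := limn_inf_gt0_eventually (fun n => average01 R n b01) b0.
have l2 : 0 < ln 2 :> R by rewrite ln_gt0 // ltr1n.
apply: (@lt_le_trans _ _ (ln 2 * c)); first exact: mulr_gt0.
apply: limr_ge; first exact: entropy_cvg.
exists N => // n /= Nn.
apply: le_trans (ler_wpM2l (ltW l2) (cN n Nn)) _.
rewrite mulrA ler_wpM2r ?invr_ge0 // mulrC mulr_natl -lnXn // -natrX.
have := card_language_ge_tree n b01 xT => le.
by rewrite ler_ln ?posrE ?ltr0n ?ler_nat ?expn_gt0 // (leq_trans _ le) // expn_gt0.
Qed.
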